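(* Let $\Delta$ be a finite simplicial complex with vertex set $V$, let $f:V\to\mathbb{R}$ be injective, and let $M$ be the greedy matching on the weighted Hasse diagram of $\Delta$. Let $\sigma\in\Delta$. If there exists $\tau\succ\sigma$ in $\Delta$ such that $\tau\setminus\sigma=\{h_f(\sigma)\}$, then $\sigma\rightarrow\tau$.
   Context: A finite simplicial complex $\Delta$ with (nonempty, finite) vertex set $V$ is a family of subsets of $V$ (simplices) containing every singleton $\{v\}$, $v\in V$, and closed under taking subsets (so $\emptyset\in\Delta$, of dimension $-1$). $\dim\sigma=|\sigma|-1$. We write $\sigma\prec\tau$ (or $\tau\succ\sigma$), ''$\sigma$ is a facet of $\tau$'', if $\sigma\subset\tau$ and $\dim\sigma=\dim\tau-1$. The Hasse diagram $H$ of $\Delta$ has the simplices of $\Delta$ as nodes and an arc $\{\sigma,\tau\}$ for each pair $\sigma\prec\tau$. The weight of the arc $\{\sigma,\tau\}$ is $f(v)$, where $\tau\setminus\sigma=\{v\}$. Two arcs sharing a node always have different weights. Greedy matching $M$: start with $M=\emptyset$; while arcs remain, add all remaining arcs of minimum weight to $M$ and delete the end nodes of these arcs (with all their incident arcs). We write $\sigma\rightarrow\tau$ if $\sigma\prec\tau$ and $\{\sigma,\tau\}\in M$. For $\sigma\in\Delta$, $H(\sigma)=\{v\in V:\ v\in\sigma,\text{ or } v\notin\sigma\text{ and }\sigma\cup\{v\}\in\Delta\}$ (the vertices whose $f$-values are the weights of the arcs incident to $\sigma$), and $h_f(\sigma)$ is the unique vertex of $H(\sigma)$ at which $f$ is minimal.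 *)

(* Defs.v *)
From HB Require Import structures.
From mathcomp Require Import all_boot all_order all_algebra.
From mathcomp Require Import reals.

Set Implicit Arguments.
Unset Strict Implicit.
Unset Printing Implicit Defensive.

Import Order.TTheory GRing.Theory Num.Theory.

Local Open Scope ring_scope.

Record simplicial_complex (V : finType) := SimplicialComplex {
  simplices : {set {set V}};
  vertices_neq0 : exists v : V, v \in [set: V];
  simplices_vertex : forall v : V, [set v] \in simplices;
  simplices_sub : forall s t : {set V},
    t \in simplices -> s \subset t -> s \in simplices
}.

Definition dim (V : finType) (s : {set V}) : int := #|s|%:Z - 1.

Definition facet (V : finType) (s t : {set V}) : bool :=
  (s \subset t) && (dim s == dim t - 1).

(* The unordered arc {s, t} of the Hasse diagram is encoded as the pair (s, t)
   with s the facet and t the coface. *)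
Notation arc V := ({set V} * {set V})%type (only parsing).

Definition hasse_arcs (V : finType) (D : simplicial_complex V) :
    {set arc V} :=
  [set a : arc V | [&& a.1 \in simplices D, a.2 \in simplices D
                     & facet a.1 a.2]].

(* When a.1 is a facet of a.2 the difference a.2 :\: a.1 is a singleton, so
   there is no choice and the default 0 is never returned: see arc_weightE. *)
Definition arc_weight (R : realType) (V : finType) (f : V -> R) (a : arc V) :
    R :=
  if [pick v in a.2 :\: a.1] is Some v then f v else 0.

Definition share_node (V : finType) (a b : arc V) : bool :=
  [|| a.1 == b.1, a.1 == b.2, a.2 == b.1 | a.2 == b.2].

Definition min_arcs (R : realType) (V : finType) (f : V -> R)
    (A : {set arc V}) : {set arc V} :=
  [set a in A | [forall b in A, arc_weight f a <= arc_weight f b]].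

(* The state of the greedy algorithm is the current matching together with the
   set of remaining arcs.  A deleted node is one whose incident arcs have all
   been removed. *)
Definition greedy_step (R : realType) (V : finType) (f : V -> R)
    (MA : {set arc V} * {set arc V}) : {set arc V} * {set arc V} :=
  let: (M, A) := MA in
  (M :|: min_arcs f A,
   [set a in A | [forall b in min_arcs f A, ~~ share_node a b]]).

(* Each step taken while arcs remain removes at least one arc and a step
   without remaining arcs changes nothing, so #|hasse_arcs D| steps run the
   loop to its end: see greedy_run_terminates and greedy_step0. *)
Definition greedy_run (R : realType) (V : finType) (D : simplicial_complex V)
    (f : V -> R) : {set arc V} * {set arc V} :=
  iter #|hasse_arcs D| (greedy_step f) (set0, hasse_arcs D).

Definition greedy_matching (R : realType) (V : finType)
    (D : simplicial_complex V) (f : V -> R) : {set arc V} :=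
  (greedy_run D f).1.

Definition matched (R : realType) (V : finType) (D : simplicial_complex V)
    (f : V -> R) (s t : {set V}) : bool :=
  facet s t && ((s, t) \in greedy_matching D f).

Definition Hset (V : finType) (D : simplicial_complex V) (s : {set V}) :
    {set V} :=
  [set v | (v \in s) || (v \notin s) && (s :|: [set v] \in simplices D)].

(* The starting point of the arg min is a dummy: for a simplex s, Hset D s is
   nonempty and the minimizer does not depend on it (h_minP, h_min_unique). *)
Definition h_min (R : realType) (V : finType) (D : simplicial_complex V)
    (f : V -> R) (s : {set V}) : V :=
  [arg min_(v < xchoose (vertices_neq0 D) in Hset D s) f v]%O.

Lemma facet_setD (V : finType) (s t : {set V}) :
  facet s t -> exists v, t :\: s = [set v].
Proof.
case/andP=> st /eqP; rewrite /dim => /addIr e.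
have {}e : #|t| = #|s|.+1.
  by apply/eqP; rewrite -eqz_nat -addn1 PoszD e subrK.
by apply/cards1P; rewrite cardsD (setIidPr st) e subSnn.
Qed.

Lemma arc_weightE (R : realType) (V : finType) (f : V -> R) (a : arc V) v :
  a.2 :\: a.1 = [set v] -> arc_weight f a = f v.
Proof.
move=> e; rewrite /arc_weight e; case: pickP => [w /set1P -> //|/(_ v)].
by rewrite set11.
Qed.

Lemma greedy_step0 (R : realType) (V : finType) (f : V -> R) M :
  greedy_step f (M, set0) = (M, set0).
Proof.
rewrite /greedy_step; congr pair; last by apply/setP=> a; rewrite !inE.
by apply/setP=> a; rewrite !inE orbF.
Qed.

Lemma min_arcs_neq0 (R : realType) (V : finType) (f : V -> R)
    (A : {set arc V}) : A != set0 -> min_arcs f A != set0.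
Proof.
case/set0Pn=> a0 a0A; apply/set0Pn.
case: (@Order.TotalTheory.arg_minP _ _ _ a0 (mem A) (arc_weight f) a0A).
move=> a aA amin; exists a.
rewrite inE; apply/andP; split=> //; apply/forall_inP => b bA; exact: amin.
Qed.

Lemma greedy_run_terminates (R : realType) (V : finType)
    (D : simplicial_complex V) (f : V -> R) : (greedy_run D f).2 = set0.
Proof.
suff H n (M A : {set arc V}) : (#|A| <= n)%N -> (iter n (greedy_step f) (M, A)).2 = set0.
  exact: H.
elim: n M A => [|n IHn] M A; first by rewrite leqn0 cards_eq0 => /eqP.
move=> An; rewrite iterSr; apply: IHn.
have [->|A0] := eqVneq A set0.
  by rewrite (_ : [set a in set0 | _] = set0) ?cards0 //;
     apply/setP=> a; rewrite !inE.
rewrite -ltnS; apply: leq_trans An; apply: proper_card; apply/properP; split.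
  by apply/subsetP=> a; rewrite inE => /andP[].
have /set0Pn[a am] := min_arcs_neq0 f A0; exists a.
  by move: am; rewrite inE => /andP[].
rewrite inE negb_and negb_forall_in; apply/orP; right.
by apply/exists_inP; exists a; rewrite // negbK /share_node eqxx.
Qed.

Lemma h_minP (R : realType) (V : finType) (D : simplicial_complex V)
    (f : V -> R) (s : {set V}) : s \in simplices D ->
  h_min D f s \in Hset D s /\
  forall v, v \in Hset D s -> f (h_min D f s) <= f v.
Proof.
move=> sD; have [v vH] : exists v, v \in Hset D s.
  have [->|/set0Pn[v vs]] := eqVneq s set0; last by exists v; rewrite inE vs.
  have [v _] := vertices_neq0 D; exists v.
  by rewrite !inE set0U simplices_vertex.
rewrite /h_min /Order.arg_min /extremum; case: pickP => [w|] /=.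
  move=> /andP[wH /forall_inP wmin]; split=> // u; exact: wmin.
have [w wH wmin] := @Order.TotalTheory.arg_minP _ _ _ v (mem (Hset D s)) f vH.
by move=> /(_ w) /negP[]; apply/andP; split=> //; apply/forall_inP.
Qed.

Lemma h_min_unique (R : realType) (V : finType) (D : simplicial_complex V)
    (f : V -> R) (s : {set V}) (w : V) : injective f -> s \in simplices D ->
  w \in Hset D s -> (forall v, v \in Hset D s -> f w <= f v) ->
  w = h_min D f s.
Proof.
move=> finj sD wH wmin; have [hH hmin] := h_minP f sD.
by apply/finj/le_anti; rewrite wmin // hmin.
Qed.

(* Main.v *)
Require Import Defs.
From HB Require Import structures.
From mathcomp Require Import all_boot all_order all_algebra.
From mathcomp Require Import reals.

(** Every arc [(s', t')] sharing a node with [(sigma, tau)] satisfies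
    [sigma \subset t'], so its weight vertex lies in [Hset D sigma].  Hence
    [(sigma, tau)] is strictly lighter than every other arc it meets, and the
    greedy procedure cannot delete such an arc without first selecting it. *)

Set Implicit Arguments.
Unset Strict Implicit.
Unset Printing Implicit Defensive.

Import Order.TTheory GRing.Theory Num.Theory.
Local Open Scope ring_scope.

Lemma greedy_matching_locally_min (R : realType) (V : finType)
    (D : simplicial_complex V) (f : V -> R) (a : {set V} * {set V}) :
  a \in hasse_arcs D ->
  (forall b, b \in hasse_arcs D -> share_node a b -> b != a ->
    arc_weight f a < arc_weight f b) ->
  a \in greedy_matching D f.
Proof.
move=> aD amin.
(* Loop invariant: [a] is selected or still remaining. At the end no arc remains, so [a] is
   selected. *)
suff H n (M A : {set {set V} * {set V}}) : A \subset hasse_arcs D ->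
    (a \in M) || (a \in A) ->
    let MA := iter n (greedy_step f) (M, A) in (a \in MA.1) || (a \in MA.2).
  have := H #|hasse_arcs D| set0 (hasse_arcs D) (subxx _).
  rewrite aD orbT => /(_ isT) /=; rewrite -/(greedy_run D f).
  by rewrite greedy_run_terminates inE orbF.
elim: n M A => [//|n IHn] M A /subsetP sAD aMA; rewrite iterSr; apply: IHn.
  by apply/subsetP => b; rewrite inE => /andP[/sAD].
case/orP: aMA => [aM|aA]; first by rewrite inE aM.
have [am|/negP am] := boolP (a \in min_arcs f A); first by rewrite inE am orbT.
apply/orP; right; rewrite inE aA; apply/forall_inP => b bm.
(* A selected [b] meeting [a] would be an arc other than [a], hence strictly heavier, although [a]
   remains and [b] has minimum weight. *)
apply/negP => ab; move: (bm); rewrite inE => /andP[bA /forall_inP/(_ a aA)].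
have ba : b != a by apply/eqP => e; case: am; rewrite -e.
by rewrite leNgt amin // sAD.
Qed.

Lemma facet_setU1 (V : finType) (s t : {set V}) v :
  facet s t -> t :\: s = [set v] -> t = v |: s.
Proof. by case/andP=> /setIidPr st _ e; rewrite -(setID t s) st e setUC. Qed.

Lemma setD_eq1_notin (V : finType) (s t : {set V}) v :
  t :\: s = [set v] -> v \notin s.
Proof. by move=> e; have := set11 v; rewrite -e inE => /andP[]. Qed.

(** Since [t = v |: s] and [t' = v |: s'], either end of an arc determines the other; the mixed
    cases [s = t'] and [t = s'] would put [v] into [s] or [s']. *)
Lemma share_node_eq (V : finType) (s t s' t' : {set V}) v :
  facet s t -> facet s' t' -> t :\: s = [set v] -> t' :\: s' = [set v] ->
  share_node (s, t) (s', t') -> (s', t') = (s, t).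
Proof.
move=> F F' e e'; rewrite /share_node /=.
have vs := setD_eq1_notin e; have vs' := setD_eq1_notin e'.
rewrite (facet_setU1 F e) (facet_setU1 F' e').
case/or4P => /eqP E.
- by rewrite E.
- by rewrite E setU11 in vs.
- by rewrite -E setU11 in vs'.
- by rewrite -E -(setU1K vs') -E (setU1K vs).
Qed.

Lemma share_node_Hset (V : finType) (D : simplicial_complex V)
    (s t s' t' : {set V}) v :
  s \subset t -> s' \subset t' -> t' \in simplices D ->
  t' :\: s' = [set v] -> share_node (s, t) (s', t') -> v \in Hset D s.
Proof.
move=> st st' tD' e' sh.
have vt' : v \in t' by have := set11 v; rewrite -e' inE => /andP[].
have sub : s \subset t'.
  case/or4P: sh => /eqP /= E; first by rewrite E.
  - by rewrite E.
  - by rewrite (subset_trans st) // E.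
  - by rewrite -E.
rewrite inE; case: (v \in s) => //=.
(* Both [s] and [v] lie in the simplex [t'], hence so does [s :|: [set v]]. *)
by apply: simplices_sub tD' _; rewrite subUset sub sub1set.
Qed.

Theorem theorem15 (R : realType) (V : finType) (D : simplicial_complex V)
    (f : V -> R) (finj : injective f)
    (sigma : {set V}) (sigmaD : sigma \in simplices D) :
  forall tau : {set V},
    tau \in simplices D -> facet sigma tau ->
    tau :\: sigma = [set h_min D f sigma] ->
    matched D f sigma tau.
Proof.
move=> tau tauD F e; rewrite /matched F /=.
apply: greedy_matching_locally_min; first by rewrite inE /= sigmaD tauD F.
case=> s t; rewrite inE /= => /and3P[sD tD F'] sh ne.
have [u e'] := facet_setD F'.
rewrite (@arc_weightE _ _ f (sigma, tau) _ e) (@arc_weightE _ _ f (s, t) _ e').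
have [st _] := andP F; have [st' _] := andP F'.
have uH := share_node_Hset st st' tD e' sh.
rewrite lt_neqAle (proj2 (h_minP f sigmaD) _ uH) andbT.
(* Equal weights force equal added vertices by injectivity, and then the two arcs coincide. *)
apply: contraNneq ne => /finj hu; rewrite -hu in e'.
by rewrite (share_node_eq F F' e e' sh).
Qed.
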